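(* Let $R=\Bbbk[x_1,\dots,x_n]$ and let $I=\prod_{j=1}^s I_j^{[p_j]}$ be a special ideal, with $I_j=(x_1,\dots,x_{\ell_j})^{a_j}$ and $I_j^{[p_j]}=(x_1^{p_j},\dots,x_{\ell_j}^{p_j})^{a_j}$. Set $J_1=I_1^{[p_1]}$ and $J_k=I_k^{[p_k]}J_{k-1}$ for $2\le k\le s$ (so $J_s=I$). Then for each $k=2,\dots,s$, starting from the minimal graded free resolution of $R/J_{k-1}$, the reduced horseshoe resolution of $R/J_k$ with respect to the ordered pair $(I_k^{[p_k]},J_{k-1})$ is a minimal graded free resolution of $R/J_k$. In particular, the iterated reduced horseshoe resolution of $R/I$ with respect to $(I_s^{[p_s]},\dots,I_1^{[p_1]})$ is minimal.
   Context: A special ideal over $R$ is $I=\prod_{j=1}^s I_j^{[p_j]}$ where $I_j=(x_1,\dots,x_{\ell_j})^{a_j}$, $I_j^{[p_j]}=(x_1^{p_j},\dots,x_{\ell_j}^{p_j})^{a_j}$, $n=\ell_1\ge\ell_2\ge\cdots\ge\ell_s\ge1$, the $p_j$ are positive integers such that $p_{j+1}/p_j$ is an integer $>1$ for $1\le j\le s-1$, and the $a_j$ are integers with $0\le a_j<p_{j+1}/p_j$ for $1\le j\le s-1$ (and $a_s\ge0$). Reduced horseshoe resolution of $R/AB$ with respect to the pair $(A,B)$ (with $A\supseteq AB$): let $\cdots\to F_2\xrightarrow{d''_2}F_1\xrightarrow{d''_1}R\to R/A\to0$ be the minimal graded free resolution of $R/A$ and $\cdots\to G_2\xrightarrow{d'_2}G_1\xrightarrow{d'_1}G_0=F_1\to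 A/AB\to0$ a minimal graded free resolution of $A/AB$ with augmentation induced by $d''_1$. The horseshoe lemma for $0\to A/AB\to R/AB\to R/A\to0$ gives degree-$0$ graded maps $\lambda_k:F_k\to G_{k-1}$ with $\lambda_1=-\mathrm{id}_{F_1}$ and $d'_{k-1}\lambda_k+\lambda_{k-1}d''_k=0$ for $k>1$. The reduced horseshoe resolution is the complex $\cdots\to G_3\oplus F_3\xrightarrow{\begin{bmatrix} d'_3&\lambda_3\\0&d''_3\end{bmatrix}} G_2\oplus F_2\xrightarrow{[\,d'_2\ \lambda_2\,]}G_1\xrightarrow{d''_1\lambda_1^{-1}d'_1}R\to R/AB\to0$ (with differentials $\begin{bmatrix} d'_k&\lambda_k\\0&d''_k\end{bmatrix}$ for $k\ge3$). Minimal means no differential matrix has a nonzero constant entry. *)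

(* Defs.v *)
From mathcomp Require Import all_boot all_algebra.
From mathcomp Require Import mpoly.
Set Implicit Arguments. Unset Strict Implicit. Unset Printing Implicit Defensive.
Import GRing.Theory.
Local Open Scope ring_scope.

Section Defs.
Variables (K : fieldType) (n : nat).
Local Notation R := {mpoly K[n]}.

Definition ideal_gen (S : R -> Prop) : R -> Prop :=
  fun q => exists t : seq (R * R),
    (forall x, x \in t -> S x.2) /\ q = \sum_(x <- t) x.1 * x.2.
Definition ideal_mul (A B : R -> Prop) : R -> Prop :=
  ideal_gen (fun q => exists u v, A u /\ B v /\ q = u * v).
Definition ideal_pow (A : R -> Prop) (e : nat) : R -> Prop :=
  iter e (ideal_mul A) (fun _ => True).
(* (x_1^p, ..., x_l^p)^e ; variable x_{i+1} is 'X_i, i : 'I_n *)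
Definition frob_ideal (l p e : nat) : R -> Prop :=
  ideal_pow (ideal_gen (fun q => exists i : 'I_n, (i < l)%N /\ q = 'X_i ^+ p)) e.
Fixpoint Jideal (l p a : nat -> nat) (k : nat) : R -> Prop :=
  match k with
  | 0 => fun _ => True
  | 1 => frob_ideal (l 1%N) (p 1%N) (a 1%N)
  | k'.+1 => ideal_mul (frob_ideal (l k) (p k) (a k)) (Jideal l p a k')
  end.

(* ---------- graded free complexes given by matrices ----------
   A complex is F_0 <- F_1 <- F_2 <- ... with F_i = free of rank r i,
   generator degrees dg i, and d i : F_(i+1) -> F_i (column vectors). *)
Definition graded_entry (e : R) (src tgt : nat) : Prop :=
  if (tgt <= src)%N then e \is (src - tgt)%N.-homog else e == 0.
Definition graded_map m1 m2 (M : 'M[R]_(m1, m2))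
  (dsrc : 'I_m2 -> nat) (dtgt : 'I_m1 -> nat) : Prop :=
  forall i j, graded_entry (M i j) (dsrc j) (dtgt i).

Definition cx_graded (r : nat -> nat) (dg : forall i, 'I_(r i) -> nat)
  (d : forall i, 'M[R]_(r i, r i.+1)) : Prop :=
  forall i, graded_map (d i) (dg i.+1) (dg i).
Definition cx_complex (r : nat -> nat) (d : forall i, 'M[R]_(r i, r i.+1)) : Prop :=
  forall i, d i *m d i.+1 = 0.
Definition cx_exact_pos (r : nat -> nat) (d : forall i, 'M[R]_(r i, r i.+1)) : Prop :=
  forall i (v : 'cV[R]_(r i.+1)), d i *m v = 0 -> exists w, d i.+1 *m w = v.
Definition is_const (e : R) : Prop := e = (e@_0%MM)%:MP.
Definition cx_minimal (r : nat -> nat) (d : forall i, 'M[R]_(r i, r i.+1)) : Prop :=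
  forall i a b, is_const (d i a b) -> d i a b = 0.

Definition graded_res_quot (A : R -> Prop) (r : nat -> nat)
  (dg : forall i, 'I_(r i) -> nat) (d : forall i, 'M[R]_(r i, r i.+1)) : Prop :=
  r 0%N = 1%N /\ (forall x, dg 0%N x = 0%N) /\ cx_graded dg d /\ cx_complex d /\
      cx_exact_pos d /\
      forall q, A q <-> exists w : 'cV[R]_(r 1%N), d 0%N *m w = const_mx q.
Definition min_graded_res_quot (A : R -> Prop) (r : nat -> nat)
  (dg : forall i, 'I_(r i) -> nat) (d : forall i, 'M[R]_(r i, r i.+1)) : Prop :=
  graded_res_quot A dg d /\ cx_minimal d.

Definition shiftG (rF rG : nat -> nat) (i : nat) : nat :=
  match i with 0 => rF 1%N | _ => rG i end.

(* G -> A/AB -> 0 minimal graded free resolution, where G_0 = F_1 and the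
   augmentation F_1 -> A/AB is induced by d''_1 = dF 0 : F_1 -> R. *)
Definition min_graded_res_aug (AB : R -> Prop) (rF : nat -> nat)
  (degF : forall i, 'I_(rF i) -> nat) (dF : forall i, 'M[R]_(rF i, rF i.+1))
  (rG : nat -> nat) (degG : forall i, 'I_(shiftG rF rG i) -> nat)
  (dG : forall i, 'M[R]_(shiftG rF rG i, shiftG rF rG i.+1)) : Prop :=
  (forall x, degG 0%N x = degF 1%N x) /\ cx_graded degG dG /\ cx_complex dG /\
      cx_exact_pos dG /\
      (forall w : 'cV[R]_(rF 1%N),
         (exists u, dG 0%N *m u = w) <-> (forall x, AB ((dF 0%N *m w) x 0))) /\
      cx_minimal dG.

(* horseshoe maps lam i = lambda_(i+1) : F_(i+1) -> G_i, of degree 0,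
   lambda_1 = -id, d'_(k-1) lambda_k + lambda_(k-1) d''_k = 0 (k > 1) *)
Definition horseshoe_maps (rF : nat -> nat)
  (degF : forall i, 'I_(rF i) -> nat) (dF : forall i, 'M[R]_(rF i, rF i.+1))
  (rG : nat -> nat) (degG : forall i, 'I_(shiftG rF rG i) -> nat)
  (dG : forall i, 'M[R]_(shiftG rF rG i, shiftG rF rG i.+1))
  (lam : forall i, 'M[R]_(shiftG rF rG i, rF i.+1)) : Prop :=
  [/\ forall i, graded_map (lam i) (degF i.+1) (degG i),
      lam 0%N = - 1%:M &
      forall j, dG j *m lam j.+1 + lam j *m dF j.+1 = 0].

Definition rkH (rF rG : nat -> nat) (i : nat) : nat :=
  match i with 0 => rF 0%N | 1 => rG 1%N | _ => (rG i + rF i)%N end.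

Definition degH (rF rG : nat -> nat)
  (degF : forall i, 'I_(rF i) -> nat)
  (degG : forall i, 'I_(shiftG rF rG i) -> nat) :
  forall i, 'I_(rkH rF rG i) -> nat :=
  fun i => match i return 'I_(rkH rF rG i) -> nat with
  | 0 => degF 0%N
  | 1 => degG 1%N
  | j.+2 => fun x => match split x with inl y => degG j.+2 y | inr z => degF j.+2 z end
  end.

Definition dH (rF rG : nat -> nat)
  (dF : forall i, 'M[R]_(rF i, rF i.+1))
  (dG : forall i, 'M[R]_(shiftG rF rG i, shiftG rF rG i.+1))
  (lam : forall i, 'M[R]_(shiftG rF rG i, rF i.+1)) :
  forall i, 'M[R]_(rkH rF rG i, rkH rF rG i.+1) :=
  fun i => match i return 'M[R]_(rkH rF rG i, rkH rF rG i.+1) with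
  | 0 => - (dF 0%N *m dG 0%N)                 (* d''_1 lambda_1^-1 d'_1 *)
  | 1 => row_mx (dG 1%N) (lam 1%N)
  | j.+2 => block_mx (dG j.+2) (lam j.+2) 0 (dF j.+2)
  end.

End Defs.
Arguments degH {rF rG} degF degG i _.


Definition special_params (n s : nat) (l p a : nat -> nat) : Prop :=
  (1 <= s)%N /\ l 1%N = n /\
      (forall j, (1 <= j < s)%N -> (l j.+1 <= l j)%N) /\ (1 <= l s)%N /\
      (forall j, (1 <= j <= s)%N -> (0 < p j)%N) /\
      (forall j, (1 <= j < s)%N ->
         [/\ (p j %| p j.+1)%N, (1 < p j.+1 %/ p j)%N & (a j < p j.+1 %/ p j)%N]).

(* Main.v *)
Require Import Defs.
From mathcomp Require Import all_boot all_algebra.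
From mathcomp Require Import mpoly.
From mathcomp Require Import zify.
Set Implicit Arguments. Unset Strict Implicit. Unset Printing Implicit Defensive.
Import GRing.Theory.
Local Open Scope ring_scope.

(* That the reduced horseshoe complex resolves [R/AB] is a diagram chase; the
   point is minimality, i.e. that the maps [lambda_k], [k > 1], vanish modulo
   the maximal ideal [m].  Write [A = (x_1^q, ..., x_l^q)^a] with [q = p_k], and
   [B = J_(k-1)].
   The syzygies of the generators of [A] have entries in
   [Q = (x_1^q, ..., x_l^q)], while [x_j^(q-1)] lies in [B] for [j <= l].  Hence
   the chain map [lambda : F -> G] over [F_1 -> F_1 / B F_1] is homotopic to
   a composite
     [F -> F_1 (x) Kos(x_j^q) -> F_1 (x) Kos(x_j^(q-1)) -> G],
   where the first arrow exists because [Kos(x_j^q)] is exact, and the middle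
   one is the map of Koszul complexes induced by [x_j^q = x_j x_j^(q-1)],
   which vanishes modulo [m] in positive degrees.  Since [F] and [G] are
   minimal, homotopic maps agree modulo [m]. *)

(** * Lifting through exact complexes, and chain maps up to homotopy *)

Lemma lift_cols (R : comNzRingType) m1 m2 m (d : 'M[R]_(m1, m2)) (M : 'M[R]_(m1, m)) :
  (forall j, exists w, d *m w = col j M) -> exists W, d *m W = M.
Proof.
move=> /fin_all_exists[w wP]; exists (\matrix_(i, j) w j i 0); apply/matrixP=> i j.
transitivity (col j M i 0); last by rewrite mxE.
by rewrite -wP !mxE; apply: eq_bigr => k _; rewrite mxE.
Qed.

Lemma exact_mx (R : comNzRingType) m0 m1 m2 (d : 'M[R]_(m0, m1)) (d' : 'M[R]_(m1, m2)) :
  (forall v : 'cV_m1, d *m v = 0 -> exists w, d' *m w = v) ->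
  forall m (M : 'M_(m1, m)), d *m M = 0 -> exists W, d' *m W = M.
Proof.
move=> ex m M dM0; apply: lift_cols => j.
by apply: ex; rewrite colE mulmxA dM0 mul0mx.
Qed.

Section Comparison.
Variables (R S : comNzRingType) (c0 : {rmorphism R -> S}).
Variables (rF rT rG : nat -> nat) (dF : forall i, 'M[R]_(rF i, rF i.+1)).
Variables (df dg : forall i, 'M[R]_(rT i, rT i.+1)) (X : forall i, 'M[R]_(rT i)).
Variables (dG : forall i, 'M[R]_(rG i, rG i.+1)) (lam : forall i, 'M[R]_(rG i, rF i)).

Hypothesis dFK : forall i, dF i *m dF i.+1 = 0.
Hypothesis dF0 : forall i, map_mx c0 (dF i) = 0.
Hypothesis df_exact : forall i (v : 'cV_(rT i.+1)), df i *m v = 0 -> exists w, df i.+1 *m w = v.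
Hypothesis dgK : forall i, dg i *m dg i.+1 = 0.
Hypothesis XP : forall i, X i *m df i = dg i *m X i.+1.
Hypothesis X0 : forall i, map_mx c0 (X i.+1) = 0.
Hypothesis dG0 : forall i, map_mx c0 (dG i) = 0.
Hypothesis dG_exact : forall i (v : 'cV_(rG i.+1)), dG i *m v = 0 -> exists w, dG i.+1 *m w = v.
Hypothesis lamP : forall i, dG i *m lam i.+1 + lam i *m dF i = 0.

(* [lam] is homotopic to [th X ps], with [ps : F -> T] and [th : T -> G]
   constructed one degree at a time; [k] is the part [h dF] of the homotopy. *)
Lemma chain_map_const0 (psi : 'M_(rT 0, rF 0)) (theta : 'M_(rG 0, rT 0)) :
  lam 0 = theta *m X 0 *m psi ->
  (exists psi', df 0 *m psi' + psi *m dF 0 = 0) ->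
  (exists theta', dG 0 *m theta' = theta *m dg 0) ->
  forall i, map_mx c0 (lam i.+1) = 0.
Proof.
move=> lam0 psiP thetaP.
(* The invariant says that [ps] and [th] lift one degree further, rather than relating them to the
   previous degree, so [psi] and [theta] start the induction with zero homotopy. The clause
   [k *m dF i = 0] makes [k] drop out of the next chain relation. *)
have main i : exists (ps : 'M_(rT i, rF i)) (th : 'M_(rG i, rT i)) h k,
    [/\ exists ps', df i *m ps' + ps *m dF i = 0,
        exists th', dG i *m th' = th *m dg i,
        lam i = th *m X i *m ps + dG i *m h + k,
        k *m dF i = 0 & map_mx c0 k = 0].
  elim: i => [|i [ps [th [h [k [[ps' ps'P] [th' th'P] lamE kd k0]]]]]].
    exists psi, theta, 0, 0; split; rewrite ?mul0mx ?map_mx0 //.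
    by rewrite mulmx0 !addr0.
  have dps' : df i *m ps' = - (ps *m dF i) by apply/eqP; rewrite -addr_eq0 ps'P.
  have [h' h'P] : exists h', dG i.+1 *m h' = lam i.+1 - th' *m X i.+1 *m ps' + h *m dF i.
    apply: (exact_mx (@dG_exact i)).
    have := lamP i; rewrite lamE !mulmxDl kd addr0 => /eqP; rewrite addr_eq0 => /eqP dlam.
    rewrite mulmxDr mulmxBr !mulmxA th'P dlam -[th *m dg i *m _]mulmxA -XP.
    rewrite -!mulmxA dps' !mulmxN.
    by rewrite opprK opprD addrAC addrNK addNr.
  exists ps', th', h', (- (h *m dF i)); split.
  - have [p pP] : exists p, df i.+1 *m p = - (ps' *m dF i.+1).
      apply: (exact_mx (@df_exact i)).
      by rewrite mulmxN mulmxA dps' mulNmx -mulmxA dFK mulmx0 !oppr0.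
    by exists p; rewrite pP addNr.
  - have [p pP] : exists p, dG i.+1 *m p = th' *m dg i.+1.
      apply: (exact_mx (@dG_exact i)).
      by rewrite mulmxA th'P -mulmxA dgK mulmx0.
    by exists p.
  - by rewrite h'P addrA addrK addrC subrK.
  - by rewrite mulNmx -mulmxA dFK mulmx0 oppr0.
  - by rewrite map_mxN map_mxM dF0 mulmx0 oppr0.
(* Degree [i.+1] matters: [X] vanishes under [c0] only in positive degree. *)
move=> i; have [ps [th [h [k [_ _ -> _ k0]]]]] := main i.+1.
by rewrite !map_mxD !map_mxM k0 X0 dG0 mulmx0 !mul0mx !addr0.
Qed.

End Comparison.

(** * Mapping cones of multiplication by a ring element *)

Section Cone.
Variable R : comNzRingType.

Definition shift_rk (r : nat -> nat) i := if i is j.+1 then r j else 0%N.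
Definition cone_rk r i := (shift_rk r i + r i)%N.

Definition shift_d r (d : forall i, 'M[R]_(r i, r i.+1)) i :
    'M_(shift_rk r i, shift_rk r i.+1) :=
  if i is j.+1 then d j else 0.
(** With [C_i = R^(r i)], degree [i] of the cone of [f : C -> C] is [C_(i-1) (+) C_i]; the sign on
    the shifted copy makes consecutive differentials cancel. *)
Definition cone_d r (d : forall i, 'M[R]_(r i, r i.+1)) (f : R) i :
    'M_(cone_rk r i, cone_rk r i.+1) :=
  block_mx (- shift_d d i) 0 (f%:M : 'M_(r i)) (d i).

Definition shift_map r (X : forall i, 'M[R]_(r i)) i : 'M_(shift_rk r i) :=
  if i is j.+1 then X j else 0.
(** Scaling the shifted summand by [x] compensates for passing from the cone on [x * g] to the cone
    on [g]. *)
Definition cone_map r (X : forall i, 'M[R]_(r i)) (x : R) i : 'M_(cone_rk r i) :=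
  block_mx (x *: shift_map X i) 0 0 (X i).

Variables (r : nat -> nat).
Implicit Types (d : forall i, 'M[R]_(r i, r i.+1)) (f x : R).

Lemma cone_complex d f : (forall i, d i *m d i.+1 = 0) ->
  forall i, cone_d d f i *m cone_d d f i.+1 = 0.
Proof.
move=> dK i; rewrite /cone_d mulmx_block /= dK !mulmx0 !mul0mx mulmxN.
rewrite mul_scalar_mx mul_mx_scalar addr0 scalerN addNr !addr0 mulNmx opprK.
by case: i => [|i] /=; rewrite ?dK ?mul0mx -?[RHS](block_mx0 _).
Qed.

(** The component of a cycle in the shifted copy is a cycle of [d], hence a boundary in positive
    degree. In degree zero being a cycle says nothing, and the third hypothesis, that [f] is a
    nonzerodivisor on the cokernel of [d 0], takes over. The other component is then corrected by
    exactness of [d]. *)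
Lemma cone_exact d f :
  (forall i (v : 'cV_(r i.+1)), d i *m v = 0 -> exists w, d i.+1 *m w = v) ->
  (forall i, d i *m d i.+1 = 0) ->
  (forall v : 'cV_(r 0), (exists w, d 0 *m w = f *: v) -> exists w, d 0 *m w = v) ->
  forall i (v : 'cV_(cone_rk r i.+1)), cone_d d f i *m v = 0 ->
    exists w, cone_d d f i.+1 *m w = v.
Proof.
move=> ex dK reg i v; rewrite -[v]vsubmxK.
move: (usubmx v) (dsubmx v) => /= v1 v2 {v}.
rewrite /cone_d mul_block_col mul0mx addr0 mul_scalar_mx mulNmx => e.
have {e} /eq_col_mx[/eqP + e2] := etrans e (esym (@col_mx0 _ (shift_rk r i) (r i) 1)).
rewrite oppr_eq0 => /eqP e1.
have [w1 w1P] : exists w1, d i *m w1 = - v1.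
  case: i v1 v2 e1 e2 => [|i] v1 v2 e1 e2 /=; last by apply: ex; rewrite mulmxN e1 oppr0.
  by apply: reg; exists v2; apply/eqP; rewrite scalerN -addr_eq0 addrC e2.
have [w2 w2P] : exists w2, d i.+1 *m w2 = v2 - f *: w1.
  by apply: ex; rewrite mulmxBr -scalemxAr w1P scalerN opprK addrC e2.
exists (col_mx w1 w2); rewrite mul_block_col mul0mx addr0 mul_scalar_mx w2P.
by rewrite mulNmx /= w1P opprK addrC subrK.
Qed.

Lemma cone_mapP (df dg : forall i, 'M[R]_(r i, r i.+1)) X x g :
  (forall i, X i *m df i = dg i *m X i.+1) ->
  forall i, cone_map X x i *m cone_d df (x * g) i = cone_d dg g i *m cone_map X x i.+1.
Proof.
move=> XP i; rewrite /cone_map /cone_d !mulmx_block !mul0mx !mulmx0 !addr0 !add0r XP.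
congr block_mx; last first.
  by rewrite mul_mx_scalar /= mul_scalar_mx scalerA mulrC.
rewrite mulmxN mulNmx -scalemxAl -scalemxAr /=.
by case: i => [|i] /=; rewrite ?XP ?mul0mx.
Qed.

(** The rank [0 + r 0] reduces to [r 0], so the image of the first differential can be read in
    ['cV_(r 0)]. *)
Lemma cone_d0 d f (w1 : 'cV_(r 0)) (w2 : 'cV_(r 1)) :
  cone_d d f 0 *m col_mx w1 w2 = f *: w1 + d 0 *m w2 :> 'cV_(r 0).
Proof.
rewrite mul_block_col mul_scalar_mx; apply/colP=> i; rewrite mxE.
by case: split_ordP => [[]//|j ij]; have /val_inj -> : val i = val j by rewrite ij.
Qed.

Lemma cone_map0 (X : forall i, 'M[R]_(r i)) x : X 0 = 1%:M -> cone_map X x 0 = 1%:M.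
Proof.
move=> X0; rewrite /cone_map X0 [RHS](@scalar_mx_block _ 0 (r 0)).
by congr block_mx; apply/matrixP=> [[]].
Qed.

End Cone.

(** * Koszul complexes as iterated cones *)

Section Koszul.
Variables (R S : comNzRingType) (c0 : {rmorphism R -> S}) (T : Type).
Implicit Types (f g x : T -> R) (s : seq T).

(** The submodule [(f_j : j in s) R^m], by recursion on [s] to follow the iterated cone. *)
Fixpoint in_span f s m (v : 'cV[R]_m) : Prop :=
  if s is j :: s' then exists u w, in_span f s' w /\ v = f j *: u + w else v = 0.

(** Regularity is read from the end of the list, the order in which cones are added, and on every
    [R^m], since the Koszul complexes take coefficients in a free module. *)
Fixpoint regular_seq f s : Prop :=
  if s is j :: s' then
    (forall m (v : 'cV[R]_m), in_span f s' (f j *: v) -> in_span f s' v)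
    /\ regular_seq f s'
  else True.

(** Both complexes and the map [X] between them are built together, one cone per element of [s].
    Each basis element of positive degree is scaled by a nonempty product of the [x j], so [X]
    vanishes under [c0] there. *)
Lemma koszul_pair f g x s r :
  (forall j, f j = x j * g j) -> (forall j, c0 (x j) = 0) -> regular_seq f s ->
  exists (rT : nat -> nat) (df dg : forall i, 'M[R]_(rT i, rT i.+1)) (X : forall i, 'M[R]_(rT i)),
  [/\ rT 0 = r, X 0 = 1%:M, forall i, map_mx c0 (X i.+1) = 0,
      forall i, X i *m df i = dg i *m X i.+1 &
  [/\ forall i, df i *m df i.+1 = 0, forall i, dg i *m dg i.+1 = 0,
      forall i (v : 'cV_(rT i.+1)), df i *m v = 0 -> exists w, df i.+1 *m w = v,
      forall v : 'cV_(rT 0), (exists w, df 0 *m w = v) <-> in_span f s v &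
      forall v : 'cV_(rT 0), (exists w, dg 0 *m w = v) <-> in_span g s v]].
Proof.
move=> fE x0; elim: s => [_|j s IHs /= [regj {}/IHs]].
  exists (fun i => if i is 0%N then r else 0%N), (fun=> 0), (fun=> 0), (fun=> 1%:M).
  split=> //.
  - by move=> i; apply/matrixP=> [[]].
  - by move=> i; rewrite mulmx0 mul0mx.
  split=> //; try by move=> i; rewrite mul0mx.
  - by move=> i v _; exists 0; apply/matrixP=> [[]].
  - by move=> v; split=> [[w <-]|->]; [|exists 0]; rewrite mul0mx.
  - by move=> v; split=> [[w <-]|->]; [|exists 0]; rewrite mul0mx.
move=> [rT [df [dg [X [r0 X0 Xm XP [dfK dgK dfE dfI dgI]]]]]].
exists (cone_rk rT), (cone_d df (f j)), (cone_d dg (g j)), (cone_map X (x j)).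
split=> //.
- exact: cone_map0.
- move=> i; rewrite map_block_mx !map_mx0 Xm map_mxZ x0 scale0r.
  exact: (block_mx0 _).
- by rewrite fE; apply: cone_mapP.
have image h (d : forall i, 'M_(rT i, rT i.+1)) :
    (forall v : 'cV_(rT 0), (exists w, d 0 *m w = v) <-> in_span h s v) ->
    forall v : 'cV_(rT 0), (exists w, cone_d d (h j) 0 *m w = v) <-> in_span h (j :: s) v.
  move=> dI v; split=> [[w]|[u [w [/dI[w' <-] ->]]]].
    rewrite -[w]vsubmxK cone_d0 => <-; do 2!eexists; split; last by [].
    by apply/dI; eexists.
  by exists (col_mx u w'); rewrite cone_d0.
split; [exact: cone_complex|exact: cone_complex| |exact: image|exact: image].
by apply: cone_exact => // v /dfI /regj /dfI.
Qed.

End Koszul.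

(** * Graded matrices, minimality, and exactness of the reduced horseshoe complex *)

Section Graded.
Variables (K : fieldType) (n : nat).
Local Notation R := {mpoly K[n]}.

Lemma graded_entry0 s t : graded_entry (0 : R) s t.
Proof. by rewrite /graded_entry; case: ifP => _ //; apply: rpred0. Qed.

Lemma graded_entryN (e : R) s t : graded_entry e s t -> graded_entry (- e) s t.
Proof. by rewrite /graded_entry; case: ifP => _; rewrite ?rpredN ?oppr_eq0. Qed.

Lemma graded_entryM (e e' : R) s u t :
  graded_entry e u t -> graded_entry e' s u -> graded_entry (e * e') s t.
Proof.
rewrite /graded_entry; case: (leqP t u) => [tu|ut /eqP->]; last first.
  by move=> _; rewrite mul0r; case: ifP => _ //; apply: rpred0.
case: (leqP u s) => [us|su _ /eqP->]; last first.
  by rewrite mulr0; case: ifP => _ //; apply: rpred0.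
rewrite (leq_trans tu us) => he he'.
by rewrite -(subnK us) -addnBA // addnC; apply: dhomogM.
Qed.

Lemma graded_map_mul m1 m2 m3 (M : 'M[R]_(m1, m2)) (N : 'M[R]_(m2, m3)) d1 d2 d3 :
  graded_map M d2 d1 -> graded_map N d3 d2 -> graded_map (M *m N) d3 d1.
Proof.
move=> gM gN i j; rewrite mxE.
elim/big_ind: _ => [|x y|k _]; first exact: graded_entry0.
  by rewrite /graded_entry; case: ifP => _; [apply: rpredD|move=> /eqP-> /eqP->; rewrite addr0].
exact: graded_entryM (gM _ _) (gN _ _).
Qed.

(** A homogeneous entry of degree zero is constant, and one of positive degree has no constant term.
    Minimality thus becomes vanishing under the ring morphism [mcoeff 0], which is compatible with
    matrix products. *)
Lemma graded_const0 (e : R) s t :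
  graded_entry e s t -> (is_const e -> e = 0) -> e@_0%MM = 0.
Proof.
rewrite /graded_entry; case: ifP => [ts he|_ /eqP-> _]; last by rewrite mcoeff0.
case: (posnP (s - t)) => [st0 /(_ _)->|st_gt0 _]; rewrite ?mcoeff0 //.
  rewrite /is_const; apply/mpolyP=> m; rewrite mcoeffC.
  have [->|m0] := eqVneq m 0%MM; rewrite ?mulr1 ?mulr0 //.
  by apply: (dhomog_nemf_coeff he); rewrite st0 /= mdeg_eq0.
by apply: (dhomog_nemf_coeff he); rewrite /= mdeg0 eq_sym -lt0n.
Qed.

Lemma graded_minimal_const0 r dg (d : forall i, 'M[R]_(r i, r i.+1)) :
  @cx_graded K n r dg d -> cx_minimal d -> forall i, map_mx (mcoeff 0%MM) (d i) = 0.
Proof.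
by move=> gd md i; apply/matrixP=> a b; rewrite !mxE (graded_const0 (gd i a b)) //; apply: md.
Qed.

Lemma minimal_of_const0 r (d : forall i, 'M[R]_(r i, r i.+1)) :
  (forall i, map_mx (mcoeff 0%MM) (d i) = 0) -> cx_minimal d.
Proof.
move=> d0 i a b ->; have /matrixP/(_ a b) := d0 i.
by rewrite !mxE => ->.
Qed.

(** Since [lam 0] is [-id], the first horseshoe relation factors [dF 1] through [dG 0]. Exactness is
    then a chase: lift the [F] component along [dF], subtract its [lam] image, and lift the rest
    along [dG]. *)
Lemma horseshoe_resolution (A AB : R -> Prop) rF degF dF rG degG dG lam :
  (forall q, AB q -> A q) ->
  @graded_res_quot K n A rF degF dF ->
  @min_graded_res_aug K n AB rF degF dF rG degG dG ->
  horseshoe_maps degF dF degG dG lam ->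
  graded_res_quot AB (degH degF degG) (dH dF dG lam).
Proof.
move=> sAB [r0 [dg0 [gF [cF [eF iF]]]]] [dgG [gG [cG [eG [iG _]]]]] [glam lam0 lamP].
have dG0lam : dG 0 *m lam 1 = dF 1.
  by apply/eqP; rewrite -subr_eq0 -[dF 1]mul1mx -mulNmx -lam0 lamP.
split; first exact: r0.
split; first exact: dg0.
split.
  move=> [|[|i]].
  - move=> /= a b; rewrite mxE; apply: graded_entryN; move: a b.
    apply: graded_map_mul (gF 0) _ => a b.
    by have := gG 0 a b; rewrite dgG.
  - move=> /= a b; rewrite /row_mx mxE /=; case: split => c; [exact: (gG 1)|exact: (glam 1)].
  - move=> /= a b; rewrite /block_mx /row_mx /col_mx !mxE /=.
    case: split => c; rewrite mxE /=; case: split => e; rewrite ?mxE.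
    + exact: (gG i.+2).
    + exact: (glam i.+2).
    + exact: graded_entry0.
    + exact: (gF i.+2).
split.
  move=> [|[|i]] /=.
  - rewrite mulNmx mul_mx_row -!mulmxA (cG 0) dG0lam (cF 0) mulmx0.
    by rewrite (row_mx0 _) oppr0.
  - by rewrite mul_row_block (cG 1) mulmx0 addr0 (lamP 1) (row_mx0 _).
  - by rewrite mulmx_block (cG i.+2) (cF i.+2) (lamP i.+2) !mulmx0 !mul0mx !addr0 (block_mx0 _).
split.
  move=> [|[|i]] /= v.
  - rewrite mulNmx -mulmxA => /eqP; rewrite oppr_eq0 => /eqP /eF[w wP].
    have [u uP] : exists u, dG 1 *m u = v - lam 1 *m w.
      by apply: eG; rewrite mulmxBr mulmxA dG0lam wP subrr.
    by exists (col_mx u w); rewrite mul_row_col uP subrK.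
  - rewrite -[v]vsubmxK; move: (usubmx v) (dsubmx v) => /= v1 v2 {v}.
    rewrite mul_row_col => e.
    (* Applying [dG 0] to the cycle equation turns [lam 1] into [dF 1] and kills the [G] term. *)
    have [w wP] : exists w, dF 2 *m w = v2.
      apply: eF; rewrite -dG0lam -mulmxA.
      have -> : lam 1 *m v2 = - (dG 1 *m v1) by apply/eqP; rewrite -addr_eq0 addrC e.
      by rewrite mulmxN mulmxA (cG 0) mul0mx oppr0.
    have [u uP] : exists u, dG 2 *m u = v1 - lam 2 *m w.
      apply: eG; rewrite mulmxBr mulmxA.
      have -> : dG 1 *m lam 2 = - (lam 1 *m dF 2) by apply/eqP; rewrite -addr_eq0 (lamP 1).
      by rewrite mulNmx opprK -mulmxA wP e.
    by exists (col_mx u w); rewrite mul_block_col mul0mx add0r uP wP subrK.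
  - rewrite -[v]vsubmxK; move: (usubmx v) (dsubmx v) => /= v1 v2 {v}.
    rewrite mul_block_col mul0mx add0r -[X in _ = X](col_mx0 _) => /eq_col_mx[e /eF[w wP]].
    have [u uP] : exists u, dG i.+3 *m u = v1 - lam i.+3 *m w.
      apply: eG; rewrite mulmxBr mulmxA.
      have -> : dG i.+2 *m lam i.+3 = - (lam i.+2 *m dF i.+3).
        by apply/eqP; rewrite -addr_eq0 (lamP i.+2).
      by rewrite mulNmx opprK -mulmxA wP e.
    by exists (col_mx u w); rewrite mul_block_col mul0mx add0r uP wP subrK.
move=> q /=; split=> [ABq|[w wP]].
  have /iF[y yP] := sAB q ABq.
  have [u uP] : exists u, dG 0 *m u = y by apply/iG => x; rewrite yP mxE.
  by exists (- u); rewrite mulNmx mulmxN opprK -mulmxA uP.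
have /iG/(_ (cast_ord (esym r0) 0)) : exists u, dG 0 *m u = dG 0 *m (- w) by eexists.
by rewrite mulmxA mulmxN -mulNmx wP mxE.
Qed.

End Graded.

(** * Ideals, and the monomials of [(x_1^q, ..., x_l^q)^a] *)

Section Ideals.
Variables (K : fieldType) (n : nat).
Local Notation R := {mpoly K[n]}.
Implicit Types (A B S : R -> Prop).

Definition ideal_closed A :=
  [/\ A 0, forall p q, A p -> A q -> A (p + q) & forall r p, A p -> A (r * p)].

Lemma ideal_gen_closed S : ideal_closed (ideal_gen S).
Proof.
split=> [|p q [s [sS ->]] [t [tS ->]]|r p [s [sS ->]]].
- by exists [::]; rewrite big_nil.
- exists (s ++ t); rewrite big_cat; split=> // x; rewrite mem_cat => /orP[/sS|/tS] //.
- exists [seq (r * x.1, x.2) | x <- s]; split=> [x /mapP[y /sS yS ->] //|].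
  by rewrite big_map mulr_sumr; apply: eq_bigr => x _; rewrite mulrA.
Qed.

Lemma ideal_gen_sub S p : S p -> ideal_gen S p.
Proof.
move=> Sp; exists [:: (1, p)]; rewrite big_seq1 mul1r; split=> // x.
by rewrite inE => /eqP->.
Qed.

Lemma ideal_gen_min S A : ideal_closed A -> (forall p, S p -> A p) ->
  forall p, ideal_gen S p -> A p.
Proof.
move=> [A0 AD AM] SA p [s [sS ->]]; rewrite big_seq.
by apply: (big_ind A) => // x /sS /SA; apply: AM.
Qed.

Lemma ideal_mul_mem A B p q : A p -> B q -> ideal_mul A B (p * q).
Proof. by move=> Ap Bq; apply: ideal_gen_sub; exists p, q. Qed.

Lemma ideal_pow_closed A e : ideal_closed (ideal_pow A e).
Proof. by case: e => [|e]; [split|apply: ideal_gen_closed]. Qed.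

Lemma Jideal_closed (l p a : nat -> nat) k : ideal_closed (@Jideal K n l p a k).
Proof.
by case: k => [|[|k]]; [split|apply: ideal_pow_closed|apply: ideal_gen_closed].
Qed.

Variables (l q : nat).
Hypothesis q_gt0 : (0 < q)%N.
Implicit Types m : 'X_{1..n}.

(* ['X_[m]] lies in [(x_1^q, ..., x_l^q)^a] iff [a <= nu m]. *)
Definition nu m := (\sum_(i < n) (i < l) * (m i %/ q))%N.

Lemma nuD m m' : (nu m + nu m' <= nu (m + m'))%N.
Proof.
rewrite /nu -big_split; apply: leq_sum => i _ /=; rewrite -mulnDr leq_mul2l; apply/orP; right.
by rewrite mnmDE leq_divRL // mulnDl leq_add // leq_divM.
Qed.

Lemma nu_mdeg m : (nu m * q <= mdeg m)%N.
Proof.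
rewrite /nu mdegE big_distrl; apply: leq_sum => i _ /=.
by rewrite -mulnA; case: (i < l)%N; rewrite ?mul0n ?mul1n // leq_divM.
Qed.

(** The bound [nu_mdeg] is a sum of bounds, one per variable, so equality in total forces equality
    in each. *)
Lemma nu_mdeg_eq a m : (a <= nu m)%N -> mdeg m = (a * q)%N ->
  forall i : 'I_n, if (i < l)%N then (q %| m i)%N else m i == 0%N.
Proof.
move=> am dm i.
have /leqif_sum [_ /esym] : forall j : 'I_n, true ->
    ((j < l) * (m j %/ q) * q <= m j ?= iff ((j < l) * (m j %/ q) * q == m j))%N.
  move=> j _; split=> //; rewrite -mulnA.
  by case: (j < l)%N; rewrite ?mul0n ?mul1n // leq_divM.
rewrite -big_distrl -mdegE /= -/(nu m) eqn_leq nu_mdeg dm leq_mul2r am orbT /=.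
move=> /forallP/(_ i); case: (i < l)%N; rewrite ?mul0n ?mul1n //.
  by move=> /= /eqP <-; rewrite dvdn_mull.
by rewrite eq_sym.
Qed.

Lemma nuDU m (j : 'I_n) : (j < l)%N -> nu (m + U_(j) *+ q)%MM = (nu m).+1.
Proof.
move=> jl; rewrite /nu (bigD1 j) //= [in RHS](bigD1 j) //= jl !mul1n.
rewrite mnmDE mulmnE mnm1E eqxx mul1n divnDr // divnn q_gt0 addn1 addSn; congr (_ + _).+1.
apply: eq_bigr => i; rewrite eq_sym => /negPf ij.
by rewrite mnmDE mulmnE mnm1E ij mul0n addn0.
Qed.

Lemma nu_gt0P m : reflect (exists2 j : 'I_n, (j < l)%N & (q <= m j)%N) (0 < nu m)%N.
Proof.
rewrite lt0n sum_nat_eq0 negb_forall; apply: (iffP existsP) => [[j]|[j jl qm]].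
  rewrite /= muln_eq0 negb_or eqb0 negbK => /andP[jl]; rewrite -lt0n divn_gt0 // => qm.
  by exists j.
by exists j; rewrite /= jl mul1n -lt0n divn_gt0.
Qed.

Lemma mnm_subU m (j : 'I_n) : (q <= m j)%N -> m = (m - U_(j) *+ q + U_(j) *+ q)%MM.
Proof.
move=> qm; rewrite submK //; apply/mnm_lepP => i; rewrite mulmnE mnm1E.
by case: eqP => [<-|_]; rewrite ?mul0n ?mul1n.
Qed.

(** Factors [x_j^q] are peeled off one at a time; [m1] collects them and [m2] is the cofactor. *)
Lemma nu_split a m : (a <= nu m)%N ->
  exists m1 m2, [/\ m = (m1 + m2)%MM, (a <= nu m1)%N & mdeg m1 = (a * q)%N].
Proof.
elim: a m => [|a IHa] m am; first by exists 0%MM, m; rewrite add0m mdeg0.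
have /nu_gt0P[j jl qm] : (0 < nu m)%N by apply: leq_trans am.
move: am; rewrite (mnm_subU qm) nuDU // ltnS => /IHa[m1 [m2 [-> am1 dm1]]].
exists (m1 + U_(j) *+ q)%MM, m2; rewrite nuDU // mdegD mdegMn mdeg1 dm1 mul1n mulSnr.
by rewrite -!addmA [(m2 + _)%MM]addmC.
Qed.

(** Membership in [frob_ideal l q a] for [q > 0], tested monomial by monomial. *)
Definition nu_ge a (p : R) := forall m, m \in msupp p -> (a <= nu m)%N.

Lemma nu_ge_closed a : ideal_closed (nu_ge a).
Proof.
split=> [m|p r pa ra m /msuppD_le|r p pa m /msuppM_le].
- by rewrite msupp0.
- by rewrite mem_cat => /orP[/pa|/ra].
- move=> /allpairsP[[m1 m2] /= [_ /pa am2 ->]].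
  by apply: leq_trans (nuD _ _); apply: leq_trans am2 (leq_addl _ _).
Qed.

Lemma nu_geM a b p r : nu_ge a p -> nu_ge b r -> nu_ge (a + b) (p * r).
Proof.
move=> pa rb m /msuppM_le /allpairsP[[m1 m2] /= [/pa am1 /rb bm2 ->]].
by apply: leq_trans (nuD _ _); apply: leq_add.
Qed.

Lemma frob_ideal_nu a p : frob_ideal l q a p -> nu_ge a p.
Proof.
elim: a p => [|a IHa] p; first by [].
apply: ideal_gen_min (nu_ge_closed _) _ p => p [u [v [uQ [/IHa va ->]]]].
rewrite -add1n; apply: nu_geM => //.
apply: ideal_gen_min (nu_ge_closed _) _ u uQ => {}p [j [jl ->]] m.
rewrite mpolyXn msuppX inE => /eqP->.
by rewrite -[(_ *+ _)%MM]add0m nuDU.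
Qed.

Lemma frob_ideal_monomial a m : (a <= nu m)%N -> @frob_ideal K n l q a 'X_[m].
Proof.
elim: a m => [|a IHa] m am //.
have /nu_gt0P[j jl qm] : (0 < nu m)%N by apply: leq_trans am.
move: am; rewrite (mnm_subU qm) nuDU // ltnS => /IHa am.
rewrite mpolyXD mulrC; apply: ideal_mul_mem am.
by rewrite -mpolyXn; apply: ideal_gen_sub; exists j.
Qed.

End Ideals.

(** * Syzygies of minimal generators of [(x_1^q, ..., x_l^q)^a] *)

Section Syzygies.
Variables (K : fieldType) (n l q a r : nat) (g : 'I_r -> {mpoly K[n]}).
Local Notation R := {mpoly K[n]}.
Implicit Types m : 'X_{1..n}.

Hypothesis q_gt0 : (0 < q)%N.
Hypothesis g_nu : forall c, nu_ge l q a (g c).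
Hypothesis g_gen : forall m, (a <= nu l q m)%N -> exists v : 'I_r -> R, \sum_c v c * g c = 'X_[m].
Hypothesis g_min : forall v : 'I_r -> R, \sum_c v c * g c = 0 -> forall c, (v c)@_0%MM = 0.

(** When the degree is not [a q], the cofactor given by [nu_split] is not 1, and multiplying by it
    removes all constant terms. *)
Lemma g_multiple m : (a <= nu l q m)%N -> mdeg m != (a * q)%N ->
  exists v : 'I_r -> R, (\sum_c v c * g c == 'X_[m]) && [forall c, (v c)@_0%MM == 0].
Proof.
move=> am dm; have [m1 [m2 [mE am1 dm1]]] := nu_split q_gt0 am.
have [v vE] := g_gen am1; exists (fun c => 'X_[m2] * v c); apply/andP; split.
  rewrite mE addmC mpolyXD -vE mulr_sumr; apply/eqP.
  by apply: eq_bigr => c _; rewrite mulrA.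
apply/forallP=> c; rewrite rmorphM /= mcoeffX.
have [m20|_] := eqVneq m2 0%MM; last by rewrite mul0r.
by move: dm; rewrite mE m20 addm0 dm1 eqxx.
Qed.

(* A [K]-combination of the [g c] without terms of degree [a q] lies in the
   maximal ideal times the ideal generated by [g], so minimality forces it to be trivial. *)
Lemma g_independent (om : 'I_r -> K) :
  (forall m, (a <= nu l q m)%N -> mdeg m = (a * q)%N -> \sum_c om c * (g c)@_m = 0) ->
  forall c, om c = 0.
Proof.
move=> omP c.
pose h : R := \sum_c om c *: g c.
have hE m : h@_m = \sum_c om c * (g c)@_m.
  by rewrite raddf_sum; apply: eq_bigr => e _; rewrite /= mcoeffZ.
have h_nu : nu_ge l q a h.
  have [A0 AD AM] := @nu_ge_closed K n l q q_gt0 a.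
  by apply: (big_ind (nu_ge l q a)) => // e _; rewrite -mul_mpolyC; apply: AM.
have vP m : m \in msupp h ->
    exists v : 'I_r -> R, (\sum_c v c * g c == 'X_[m]) && [forall c, (v c)@_0%MM == 0].
  move=> hm; apply: g_multiple; first exact: h_nu.
  apply: contraTneq hm => dm; rewrite -mcoeff_eq0 hE.
  have [am|am] := leqP a (nu l q m); first by rewrite omP.
  rewrite big1 // => e _; rewrite [_@_m]memN_msupp_eq0 ?mulr0 //.
  by apply: contraL am => /g_nu; rewrite -leqNgt.
have [V [VE V0]] : exists V : 'I_r -> R, \sum_c V c * g c = h /\ forall c, (V c)@_0%MM = 0.
  rewrite [h]mpolyE big_seq.
  apply: (big_ind (fun p : R => exists V : 'I_r -> R,
    \sum_c V c * g c = p /\ forall c, (V c)@_0%MM = 0)).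
  - exists (fun=> 0); split=> [|e]; last by rewrite mcoeff0.
    by rewrite big1 // => e _; rewrite mul0r.
  - move=> _ _ [V [<- V0]] [W [<- W0]]; exists (fun e => V e + W e).
    split=> [|e]; last by rewrite mcoeffD V0 W0 addr0.
    by rewrite -big_split; apply: eq_bigr => e _; rewrite mulrDl.
  - move=> m /vP[v /andP[/eqP <- /forallP v0]]; exists (fun e => h@_m *: v e).
    split=> [|e]; last by rewrite mcoeffZ (eqP (v0 e)) mulr0.
    by rewrite scaler_sumr; apply: eq_bigr => e _; rewrite scalerAl.
have /(_ c) : forall c, (om c *: 1 - V c)@_0%MM = 0.
  apply: g_min; transitivity (h - h); last exact: subrr.
  rewrite -{2}VE -sumrB; apply: eq_bigr => e _.
  by rewrite mulrBl -scalerAl mul1r.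
by rewrite mcoeffB mcoeffZ mcoeff1 eqxx mulr1 V0 subr0.
Qed.

Lemma syzygy_nu (w : 'I_r -> R) : \sum_c w c * g c = 0 -> forall c, nu_ge l q 1 (w c).
Proof.
move=> w0.
(* Induction on the degree of a monomial [dl] outside [Q] of some [w c]: the
   coefficient of [dl + m] in the relation only involves [dl] and [m]. *)
suff main d : forall dl, (mdeg dl < d)%N -> nu l q dl = 0%N -> forall c, (w c)@_dl = 0.
  move=> c dl; rewrite mcoeff_msupp lt0n; apply: contra => /eqP dl0.
  by rewrite (main (mdeg dl).+1).
elim: d => // d IHd dl; rewrite ltnS => dld dl0; apply: g_independent => m am dm.
transitivity ((\sum_c w c * g c)@_(dl + m)); last by rewrite w0 mcoeff0.
rewrite raddf_sum; apply: eq_bigr => c _ /=; apply/esym.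
have mE := nu_mdeg_eq am dm.
(* For [i < l], [q] divides [m i] and [dl i < q], so adding [dl] produces no carry. *)
have nudm : nu l q (dl + m) = a.
  have aE : nu l q m = a.
    apply/eqP; rewrite eqn_leq am andbT -(leq_pmul2r q_gt0) -dm; exact: nu_mdeg.
  rewrite -[RHS]aE /nu; apply: eq_bigr => i _; case: ltnP => // il.
  have := mE i; rewrite il => qm; rewrite mnmDE divnDr //.
  move: dl0; rewrite /nu => /eqP; rewrite sum_nat_eq0 => /forallP/(_ i).
  by rewrite il /= mul1n => /eqP->.
have b1 : (mdeg dl < (mdeg (dl + m)).+1)%N by rewrite ltnS mdegD leq_addr.
have b2 : (mdeg m < (mdeg (dl + m)).+1)%N by rewrite ltnS mdegD leq_addl.
rewrite mcoeffM (bigD1 (BMultinom b1, BMultinom b2)) //= big1 ?addr0 // => [[k1 k2]] /=.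
move=> /andP[/eqP kE]; apply: contraNeq; rewrite mulf_eq0 negb_or => /andP[wk gk].
have ak2 : (a <= nu l q k2)%N by apply: (g_nu (c := c)); rewrite mcoeff_msupp.
have nuk : (nu l q k1 + nu l q k2 <= a)%N by have := nuD l q_gt0 k1 k2; rewrite -kE nudm.
have nuk1 : nu l q k1 = 0%N by lia.
have dk2 : (a * q <= mdeg k2)%N.
  by apply: leq_trans (nu_mdeg l q k2); rewrite leq_mul2r ak2 orbT.
have dk1 : (d <= mdeg k1)%N.
  by rewrite leqNgt; apply: contra wk => lt; rewrite IHd.
have dE : (mdeg dl + mdeg m = mdeg k1 + mdeg k2)%N by rewrite -!mdegD -kE.
(* The bounds [mdeg dl <= d <= mdeg k1] and [a q <= mdeg k2] must be equalities, as the total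
   degrees agree. *)
have dk2' : mdeg k2 = (a * q)%N by lia.
have k2E := nu_mdeg_eq ak2 dk2'.
(* Beyond the first [l] variables [m] and [k2] vanish; within them both are multiples of [q], so
   [dl] and [k1], with exponents below [q], are the same residue. *)
have k1E : k1 = dl :> 'X_{1..n}.
  apply/mnmP => i.
  have kEi : (dl i + m i = k1 i + k2 i)%N by rewrite -!mnmDE -kE.
  have := mE i; have := k2E i.
  have lt0 (k : 'X_{1..n}) : nu l q k = 0%N -> (i < l)%N -> (k i < q)%N.
    move=> k0 il; rewrite ltnNge; apply/negP => qk.
    have /(nu_gt0P _ q_gt0) : exists2 j : 'I_n, (j < l)%N & (q <= k j)%N by exists i.
    by rewrite k0.
  case: ltnP => il; last by move=> /eqP k2i /eqP mi; lia.
  move=> qk2 qm; rewrite -(modn_small (lt0 _ nuk1 il)) -(modn_small (lt0 _ dl0 il)).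
  move: (congr1 (modn^~ q) kEi); rewrite -modnDmr (eqP qm) addn0.
  by rewrite -[in RHS]modnDmr (eqP qk2) addn0.
have k2E' : k2 = m :> 'X_{1..n}.
  by apply: (@addmI _ dl); rewrite [RHS]kE k1E.
by apply/andP; split; apply/eqP; apply: val_inj.
Qed.

End Syzygies.

(** * Closure properties of the submodules [(f_j) R^m] *)

Section Span.
Variables (R : comNzRingType) (T : eqType) (f : T -> R).
Implicit Types s : seq T.

Lemma in_span0 s m : in_span f s (0 : 'cV[R]_m).
Proof. by elim: s => //= j s IHs; exists 0, 0; rewrite scaler0 addr0. Qed.

Lemma in_spanD s m (v w : 'cV[R]_m) : in_span f s v -> in_span f s w -> in_span f s (v + w).
Proof.
elim: s v w => [|j s IHs] v w /=; first by move=> -> ->; rewrite addr0.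
move=> [u [v' [v's ->]]] [u' [w' [w's ->]]]; exists (u + u'), (v' + w').
by split; [apply: IHs|rewrite scalerDr addrACA].
Qed.

Lemma in_span_mul s m m' (A : 'M[R]_(m', m)) (v : 'cV[R]_m) :
  in_span f s v -> in_span f s (A *m v).
Proof.
elim: s v => [|j s IHs] v /=; first by move=> ->; rewrite mulmx0.
move=> [u [w [ws ->]]]; exists (A *m u), (A *m w).
by split; [apply: IHs|rewrite mulmxDr scalemxAr].
Qed.

Lemma in_span_scale s m (v : 'cV[R]_m) j : j \in s -> in_span f s (f j *: v).
Proof.
elim: s => //= i s IHs; rewrite inE => /predU1P[->|/IHs sv].
  by exists v, 0; rewrite addr0; split=> //; apply: in_span0.
by exists 0, (f j *: v); rewrite scaler0 add0r.
Qed.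

Lemma in_span_ind s m (P : 'cV[R]_m -> Prop) :
  P 0 -> (forall v w, P v -> P w -> P (v + w)) ->
  (forall j v, j \in s -> P (f j *: v)) -> forall v, in_span f s v -> P v.
Proof.
move=> P0 PD; elim: s => [|j s IHs] PM v /=; first by move=> ->.
move=> [u [w [ws ->]]]; apply: PD; first by apply: PM; rewrite mem_head.
by apply: IHs ws => i x si; apply: PM; rewrite inE si orbT.
Qed.

End Span.

(** * Powers of the variables: regularity and membership in [J_k] *)

Section Powers.
Variables (K : fieldType) (n q : nat).
Local Notation R := {mpoly K[n]}.
Implicit Types (s : seq 'I_n) (p : R).

Lemma in_span_powerP s r (v : 'cV[R]_r) :
  in_span (fun j => 'X_j ^+ q) s v <->
  forall i m, m \in msupp (v i 0) -> has (fun j => q <= m j)%N s.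
Proof.
split.
  move: v; apply: in_span_ind => [i m|v w vs ws i m|j v js i m].
  - by rewrite mxE msupp0.
  - by rewrite mxE => /msuppD_le; rewrite mem_cat => /orP[/vs|/ws].
  - rewrite mxE mpolyXn => /msuppM_le /allpairsP[[m1 m2] /= []].
    rewrite msuppX inE => /eqP-> _ ->; apply/hasP; exists j => //.
    by rewrite mnmDE mulmnE mnm1E eqxx mul1n leq_addr.
pose X_span : 'cV_r -> Prop := in_span (fun j => 'X_j ^+ q : R) s (m := r).
move=> vs; rewrite [v]matrix_sum_delta.
apply: (big_ind X_span) => [||i _]; [exact: in_span0|exact: in_spanD|].
rewrite big_ord1 [v i 0]mpolyE scaler_suml big_seq.
apply: (big_ind X_span) => [||m /vs/hasP[j js qm]]; [exact: in_span0|exact: in_spanD|].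
rewrite (mnm_subU qm) mpolyXD -mpolyXn -mul_mpolyC mulrA mulrC -scalerA.
exact: in_span_scale.
Qed.

(** Multiplication by [x_i^q] changes only the exponent of [x_i], and [i] is not in the tail, so
    divisibility by the other powers is unaffected. *)
Lemma power_regular s : uniq s -> regular_seq (fun j => 'X_j ^+ q : R) s.
Proof.
elim: s => //= i s IHs /andP[is_ /IHs reg]; split=> // r v /in_span_powerP vs.
apply/in_span_powerP => c m mv.
have /vs/hasP[j js] : (m + U_(i) *+ q)%MM \in msupp (('X_i ^+ q *: v) c 0).
  by rewrite mxE mulrC mpolyXn mcoeff_msupp addmC mcoeffMX -mcoeff_msupp.
rewrite mnmDE mulmnE mnm1E; case: eqP => [ij|_]; first by rewrite ij js in is_.
by rewrite mul0n addn0 => qm; apply/hasP; exists j.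
Qed.

Lemma ideal_pow_exp (A : R -> Prop) p e : A p -> ideal_pow A e (p ^+ e).
Proof.
by move=> Ap; elim: e => // e IHe; rewrite exprS; apply: ideal_mul_mem.
Qed.

(* The exponent sum telescopes: [sum_(i <= j) p_i a_i <= sum_(i <= j) (p_(i+1) - p_i) < p_(j+1)]. *)
Lemma power_in_Jideal (l p a : nat -> nat) (s j : nat) (i : 'I_n) :
  special_params n s l p a -> (1 <= j < s)%N -> (i < l j)%N ->
  exists2 e, (e < p j.+1)%N & @Jideal K n l p a j ('X_i ^+ e).
Proof.
move=> [_ [_ [l_dec [_ [p_gt0 pa]]]]].
elim: j => // j IHj js il.
have [pdvd _ ap] := pa j.+1 js.
have p1 : (0 < p j.+1)%N by apply: p_gt0; case/andP: js => -> /ltnW.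
have pap : (p j.+1 * a j.+1 + p j.+1 <= p j.+2)%N.
  by rewrite -mulnSr -(divnK pdvd) mulnC leq_mul2r ap orbT.
have frob : @frob_ideal K n (l j.+1) (p j.+1) (a j.+1) ('X_i ^+ (p j.+1 * a j.+1)).
  by rewrite exprM; apply: ideal_pow_exp; apply: ideal_gen_sub; exists i.
case: j => [|j] in IHj js il pdvd ap p1 pap frob *.
  by exists (p 1%N * a 1%N)%N; [lia|].
have js' : (1 <= j.+1 < s)%N by lia.
have [e ep eJ] := IHj js' (leq_trans il (l_dec _ js')).
exists (p j.+2 * a j.+2 + e)%N; first by lia.
by rewrite exprD; apply: ideal_mul_mem.
Qed.

Lemma l_antitone (l p a : nat -> nat) (s j k : nat) :
  special_params n s l p a -> (1 <= j)%N -> (j <= k <= s)%N -> (l k <= l j)%N.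
Proof.
move=> [_ [_ [l_dec _]]] j1 /andP[jk]; elim: k jk => [|k IHk]; first by lia.
rewrite leq_eqVlt => /predU1P[-> //|jk ks].
by apply: leq_trans (IHk _ _); [apply: l_dec|..]; lia.
Qed.

End Powers.

(** * Minimality of the reduced horseshoe resolution *)

Theorem theorem3p5 (K : fieldType) (n s : nat) (l p a : nat -> nat)
  (Hsp : special_params n s l p a) (k : nat) (Hk : (2 <= k <= s)%N)
  (rF : nat -> nat) (degF : forall i, 'I_(rF i) -> nat)
  (dF : forall i, 'M[{mpoly K[n]}]_(rF i, rF i.+1))
  (HF : min_graded_res_quot (@frob_ideal K n (l k) (p k) (a k)) degF dF)
  (rG : nat -> nat) (degG : forall i, 'I_(shiftG rF rG i) -> nat)
  (dG : forall i, 'M[{mpoly K[n]}]_(shiftG rF rG i, shiftG rF rG i.+1))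
  (HG : min_graded_res_aug (@Jideal K n l p a k) degF dF degG dG)
  (lam : forall i, 'M[{mpoly K[n]}]_(shiftG rF rG i, rF i.+1))
  (Hlam : horseshoe_maps degF dF degG dG lam) :
  min_graded_res_quot (@Jideal K n l p a k)
    (degH degF degG) (dH dF dG lam).
Proof.
have [_ [_ [_ [_ [p_gt0 _]]]]] := Hsp.
have q_gt0 : (0 < p k)%N by apply: p_gt0; lia.
have [k' kE] : exists k', k = k'.+2 by exists k.-2; lia.
have [resF minF] := HF; have [r0 [_ [gF [cF [eF iF]]]]] := resF.
have [dgG [gG [cG [eG [iG minG]]]]] := HG.
have [glam lam0 lamP] := Hlam.
(* [rF 0] equals 1 only propositionally, so its single index is obtained by a cast. *)
pose x0 : 'I_(rF 0%N) := cast_ord (esym r0) 0.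
have x0E x : x = x0 by apply: val_inj => /=; case: x => [[|x]] //=; rewrite r0.
have const_x0 (v : 'cV[{mpoly K[n]}]_(rF 0%N)) : v = const_mx (v x0 0).
  by apply/colP => x; rewrite mxE (x0E x).
have A_closed : ideal_closed (@frob_ideal K n (l k) (p k) (a k)) by apply: ideal_pow_closed.
have AE (v : 'cV[{mpoly K[n]}]_(rF 1%N)) x : frob_ideal (l k) (p k) (a k) ((dF 0%N *m v) x 0).
  by apply/iF; exists v; rewrite (x0E x) -const_x0.
have JA q : @Jideal K n l p a k q -> frob_ideal (l k) (p k) (a k) q.
  move: q A_closed; rewrite kE => q A_closed.
  apply: (ideal_gen_min A_closed) q => _ [u [v [uA [_ ->]]]].
  by rewrite mulrC; case: A_closed => _ _; apply.
have resH := horseshoe_resolution JA resF HG Hlam.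
split=> //; apply: minimal_of_const0.
have F0 := graded_minimal_const0 gF minF; have G0 := graded_minimal_const0 gG minG.
(* The [dF] and [dG] blocks of [dH] already vanish modulo the maximal ideal, which leaves the blocks
   [lam i.+1]. *)
suff lam_const0 i : map_mx (mcoeff 0%MM) (lam i.+1) = 0.
  move=> [|[|i]] /=.
  - by rewrite map_mxN map_mxM F0 mul0mx oppr0.
  - by rewrite map_row_mx (G0 1%N) lam_const0 (row_mx0 _).
  - by rewrite map_block_mx (G0 i.+2) (F0 i.+2) lam_const0 map_mx0 (block_mx0 _).
pose vars := [seq j : 'I_n <- enum 'I_n | (j < l k)%N].
have vars_uniq : uniq vars by rewrite filter_uniq ?enum_uniq.
have gJ j : j \in vars -> @Jideal K n l p a k'.+1 ('X_j ^+ (p k).-1).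
  rewrite mem_filter => /andP[jl _].
  have [||e ep eJ] := @power_in_Jideal K n l p a s k'.+1 j Hsp; first by lia.
    by apply: leq_trans jl (l_antitone Hsp _ _); lia.
  have [_ _ JM] := @Jideal_closed K n l p a k'.+1.
  by rewrite -kE in ep; rewrite -(@subnK e (p k).-1) ?exprD; [apply: JM|lia].
have synF (w : 'cV[{mpoly K[n]}]_(rF 1%N)) :
    dF 0%N *m w = 0 -> in_span (fun j => 'X_j ^+ p k) vars w.
  move=> w0; apply/in_span_powerP => c m mw.
  have sumE (v : 'cV[{mpoly K[n]}]_(rF 1%N)) :
      \sum_c v c 0 * dF 0%N x0 c = (dF 0%N *m v) x0 0.
    by rewrite mxE; apply: eq_bigr => e _; rewrite mulrC.
  have : nu_ge (l k) (p k) 1 (w c 0).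
    apply: (@syzygy_nu K n (l k) (p k) (a k) _ (dF 0%N x0) q_gt0 _ _ _ (fun e => w e 0)).
    - move=> e; apply: frob_ideal_nu => //.
      by have := AE (delta_mx e 0) x0; rewrite -colE mxE.
    - move=> m' am; have /iF[v vE] := @frob_ideal_monomial K n _ _ q_gt0 _ _ am.
      by exists (fun e => v e 0); rewrite sumE vE mxE.
    (* Syzygies come from [dF 1], whose entries have no constant term by minimality. *)
    - move=> v v0 e; have [u uE] : exists u, dF 1%N *m u = \col_e v e.
        apply: eF; rewrite [LHS]const_x0 -sumE; apply/colP => x; rewrite [LHS]mxE [RHS]mxE.
        by rewrite -[RHS]v0; apply: eq_bigr => e' _; rewrite mxE.
      have /colP/(_ e) := congr1 (map_mx (mcoeff 0%MM)) uE.
      by rewrite map_mxM F0 mul0mx !mxE.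
    - by rewrite sumE w0 mxE.
  move=> /(_ _ mw) /(nu_gt0P _ q_gt0)[j jl qm]; apply/hasP; exists j => //.
  by rewrite mem_filter jl mem_enum.
have fE (j : 'I_n) : 'X_j ^+ p k = 'X_j * 'X_j ^+ (p k).-1 :> {mpoly K[n]}.
  by rewrite -exprS prednK.
have x_const0 (j : 'I_n) : ('X_j : {mpoly K[n]})@_0%MM = 0 by rewrite mcoeffX mnm1_eq0.
have [rT [df [dg [X [rT0 X0 Xm XP [dfK dgK dfE dfI dgI]]]]]] :=
  koszul_pair (rF 1%N) fE x_const0 (power_regular K (p k) vars_uniq).
(* [F] enters shifted by one, so that it starts at [F_1 = G_0]. As [rT 0 = rF 1] is only
   propositional, [pid_mx] plays the identity; the sign is that of [lam 0]. *)
apply: (@chain_map_const0 _ _ (mcoeff 0%MM) (fun i => rF i.+1) rT (shiftG rF rG)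
  (fun i => dF i.+1) df dg X dG lam _ _ dfE dgK XP Xm G0 eG lamP (pid_mx (rF 1%N)) (- pid_mx (rF 1%N))).
- by move=> j; apply: cF.
- by move=> j; apply: F0.
- by rewrite lam0 X0 mulmx1 mulNmx mul_pid_mx rT0 !minnn pid_mx_1.
(* The columns of [dF 1] are syzygies, so by [synF] they lie in [Q F_1], the image of [df 0]. *)
- have [W WE] : exists W, df 0%N *m W = - (pid_mx (rF 1%N) *m dF 1%N).
    apply: lift_cols => j; apply/dfI; rewrite -mulmxN colE -!mulmxA.
    apply: in_span_mul; rewrite mulNmx -mulmxN; apply: synF.
    by rewrite mulmxA cF mul0mx.
  by exists W; rewrite WE addNr.
(* The image of [dg 0] is spanned by multiples of [x_j^(q-1)], which lies in [B]; [dF 0] sends these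
   into [AB], and [iG] lifts them along [dG 0]. *)
- apply: lift_cols => j; rewrite colE -mulmxA.
  have := (dgI _).1 (ex_intro _ (delta_mx j 0) erefl).
  move=> /(in_span_mul (- pid_mx (rF 1%N) : 'M_(rF 1%N, _))).
  move: (_ *m _); apply: in_span_ind => [|v w [v' <-] [w' <-]|j' v jv].
  + by exists 0; rewrite mulmx0.
  + by exists (v' + w'); rewrite mulmxDr.
  + apply/iG => x; rewrite -scalemxAr mxE kE mulrC.
    by apply: ideal_mul_mem; [rewrite -kE; apply: AE|rewrite -kE; apply: gJ].
Qed.
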